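(* Let $p\in\mathcal{P}(\mathbb{R}^n)$ and for $k\in\mathbb{N}=\{1,2,\dots\}$ define $p_k\in\mathcal{P}(\mathbb{R}^n)$ by $$\frac1{p_k(x)}=\frac1{k+1}+\frac{k-1}{k+1}\,\frac1{p(x)}.$$ Then: (1) $\frac1{p_k}\to\frac1p$ uniformly on $\mathbb{R}^n$ as $k\to\infty$. (2) $p_k\to p$ almost everywhere as $k\to\infty$. (3) For every $k$, $1+\frac1k\le p_k^-\le p_k^+\le k+1$ and $\min\{p^-,2\}\le p_k^-\le p_k^+\le\max\{p^+,2\}$. (4) If $p\in\mathcal{A}$, then for every $k$, $p_k\in\mathcal{A}$ and $[p_k]_{\mathcal{A}}\le 8\,[p]_{\mathcal{A}}$. (5) If $p\in\mathcal{N}$, then for every $k$, $p_k\in\mathcal{N}$ and $[p_k]_{\mathcal{N}}\le 2\,[p]_{\mathcal{N}}$. (6) If $f\in L^2(\mathbb{R}^n)$, then $$\lim_{k\to\infty}\tilde\rho_{p_k(\cdot)}(f)=\tilde\rho_{p(\cdot)}(f)\qquad\text{and}\qquad\lim_{k\to\infty}\|f\|_{\tilde\rho_{p_k(\cdot)}}=\|f\|_{\tilde\rho_{p(\cdot)}}$$ (as limits in $[0,\infty]$).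
   Context: Variable exponents: $\mathcal{P}(\mathbb{R}^n)$ is the set of measurable functions $p:\mathbb{R}^n\to[1,\infty]$, with $\frac1\infty=0$. Put $p^-=\operatorname{ess\,inf}_{x\in\mathbb{R}^n}p(x)$ and $p^+=\operatorname{ess\,sup}_{x\in\mathbb{R}^n}p(x)$. The conjugate exponent $p'\in\mathcal{P}(\mathbb{R}^n)$ is defined by $\frac1{p(x)}+\frac1{p'(x)}=1$. Modulars and norms: for measurable $f$ on $\mathbb{R}^n$ let $$\rho_{p(\cdot)}(f)=\int_{\mathbb{R}^n}|f(x)|^{p(x)}\,dx,\qquad \tilde\rho_{p(\cdot)}(f)=\int_{\mathbb{R}^n}\frac1{p(x)}|f(x)|^{p(x)}\,dx,$$ with the convention $t^\infty=0$ for $t\in[0,1]$ and $t^\infty=\infty$ for $t>1$; likewise, at points where $p(x)=\infty$ the expression $\frac1{p(x)}t^{p(x)}$ is understood as $0$ for $t\in[0,1]$ and $\infty$ for $t>1$. Let $$\|f\|_{p(\cdot)}=\inf\{\lambda>0:\rho_{p(\cdot)}(f/\lambda)\le1\},\qquad \|f\|_{\tilde\rho_{p(\cdot)}}=\inf\{\lambda>0:\tilde\rho_{p(\cdot)}(f/\lambda)\le1\}$$ (with $\inf\emptyset=\infty$). $L^{p(\cdot)}(\mathbb{R}^n)$ is the set of measurable $f$ with $\|f\|_{p(\cdot)}<\infty$. Cubes are taken with sides parallel to the coordinate axes; $|Q|$ is the Lebesgue measure of $Q$ and $\mathbf{1}_Q$ its indicator function. Muckenhoupt condition: $p\in\mathcal{A}$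 means $$[p]_{\mathcal{A}}=\sup_Q\frac{\|\mathbf{1}_Q\|_{p(\cdot)}\,\|\mathbf{1}_Q\|_{p'(\cdot)}}{|Q|}<\infty,$$ the supremum being over all cubes $Q\subset\mathbb{R}^n$. Nekvinda condition: $p\in\mathcal{N}$ means there exists $p_\infty\in[1,\infty]$ such that the constant function $1$ belongs to $L^{s(\cdot)}(\mathbb{R}^n)$, where $s\in\mathcal{P}(\mathbb{R}^n)$ is defined by $\frac1{s(x)}=\left|\frac1{p(x)}-\frac1{p_\infty}\right|$ (with $s(x)=\infty$ when the right-hand side is $0$). In that case $[p]_{\mathcal{N}}=\|1\|_{s(\cdot)}$. *)

(* Defs.v *)
From HB Require Import structures.
From mathcomp Require Import all_boot all_order all_algebra.
From mathcomp Require Import all_classical all_reals all_analysis.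
From mathcomp Require Import measurable_realfun ess_sup_inf.

Set Implicit Arguments.
Unset Strict Implicit.
Unset Printing Implicit Defensive.

Import Order.TTheory GRing.Theory Num.Theory.
Import numFieldNormedType.Exports.

Local Open Scope classical_set_scope.
Local Open Scope ring_scope.
Local Open Scope ereal_scope.

Section tuple_cons_measure.
Context {R : realType} (n : nat).

Definition tuple_cons (z : n.-tuple R * measurableTypeR R) : n.+1.-tuple R :=
  [tuple of (z.2 : R) :: z.1].

Lemma measurable_tuple_cons : measurable_fun setT tuple_cons.
Proof.
apply: measurable_cons; last exact: measurable_fst.
exact: measurable_snd.
Qed.

Variable mu : {measure set (n.-tuple R) -> \bar R}.

Definition cons_lebesgue : set (n.+1.-tuple R) -> \bar R :=
  pushforward (mu \x (@lebesgue_measure R)) tuple_cons.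

Let P := measure_function_pushforward__canonical__measure_function_Measure
  (mu \x (@lebesgue_measure R)) measurable_tuple_cons.

Let cons_lebesgue0 : cons_lebesgue set0 = 0.
Proof. exact: (measure0 P). Qed.

Let cons_lebesgue_ge0 A : 0 <= cons_lebesgue A.
Proof. exact: (measure_ge0 P). Qed.

Let cons_lebesgue_sigma_additive : semi_sigma_additive cons_lebesgue.
Proof. exact: (@measure_semi_sigma_additive _ _ _ P). Qed.

HB.instance Definition _ := isMeasure.Build _ _ _ cons_lebesgue
  cons_lebesgue0 cons_lebesgue_ge0 cons_lebesgue_sigma_additive.

End tuple_cons_measure.

(* The n-fold product of the one-dimensional Lebesgue measure, on the Borel
   sets; for n = 0 it is the unit mass at the only point. *)
Fixpoint borel_lebesgue (R : realType) (n : nat) :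
    {measure set (n.-tuple R) -> \bar R} :=
  match n with
  | 0%N => dirac ([tuple] : 0.-tuple R)
  | m.+1 => cons_lebesgue (borel_lebesgue R m)
  end.

(* R^n with the sigma-algebra of Lebesgue measurable sets: the Caratheodory
   measurable sets of the outer measure induced by borel_lebesgue. *)
Definition Rn (R : realType) (n : nat) :=
  caratheodory_type ((borel_lebesgue R n)^*)%mu.
HB.instance Definition _ (R : realType) (n : nat) := Measurable.on (Rn R n).

Definition lebesgue (R : realType) (n : nat) : set (Rn R n) -> \bar R :=
  @completed_measure_extension _ _ _ (borel_lebesgue R n).
HB.instance Definition _ (R : realType) (n : nat) :=
  Measure.on (@lebesgue R n).

Section variable_exponents.
Context {R : realType} (n : nat).
Local Notation mu := (@lebesgue R n).
Implicit Types (p : Rn R n -> \bar R) (f : Rn R n -> R).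

Definition exponent p :=
  measurable_fun setT p /\ forall x, 1 <= p x.

(* In \bar R, +oo^-1 = 0 and 0^-1 = +oo, so this gives 1' = +oo and +oo' = 1. *)
Definition conjugate p x := (1 - (p x)^-1)^-1.

(* t ^ q and (1 / q) t ^ q for t >= 0 and q in [1, +oo]; the second is not
   q^-1 * t ^ q at q = +oo, as 0 * +oo = 0 in \bar R. The value at q = -oo is
   irrelevant. *)
Definition epow (t : R) (q : \bar R) : \bar R :=
  match q with
  | r%:E => (t `^ r)%:E
  | +oo => if (t <= 1)%R then 0 else +oo
  | -oo => 0
  end.

Definition epow_div (t : R) (q : \bar R) : \bar R :=
  match q with
  | r%:E => (r^-1 * t `^ r)%:E
  | +oo => if (t <= 1)%R then 0 else +oo
  | -oo => 0
  end.

Definition modular p f := \int[mu]_x epow `|f x|%R (p x).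

Definition modular_tilde p f := \int[mu]_x epow_div `|f x|%R (p x).

Definition luxemburg (rho : (Rn R n -> R) -> \bar R) f : \bar R :=
  ereal_inf [set l%:E | l in
    [set l : R | (0 < l)%R /\ rho (fun x => f x / l)%R <= 1]].

Definition vnorm p f := luxemburg (modular p) f.

Definition vnorm_tilde p f := luxemburg (modular_tilde p) f.

Definition vLebesgue p : set (Rn R n -> R) :=
  [set f | measurable_fun setT f /\ vnorm p f < +oo].

Definition cube (a : n.-tuple R) (l : R) : set (Rn R n) :=
  [set x : n.-tuple R | forall i, (tnth a i <= tnth x i <= tnth a i + l)%R].

Definition cubes : set (set (Rn R n)) :=
  [set Q | exists a l, (0 < l)%R /\ Q = cube a l].

Definition muckenhoupt_const p : \bar R :=
  ereal_sup [set vnorm p \1_Q * vnorm (conjugate p) \1_Q / mu Q | Q in cubes].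

Definition muckenhoupt p := muckenhoupt_const p < +oo.

Definition nekvinda_exponent p (q : \bar R) x := `|(p x)^-1 - q^-1|^-1.

Definition nekvinda_limits p : set (\bar R) :=
  [set q | 1 <= q /\ vLebesgue (nekvinda_exponent p q) (cst 1%R)].

Definition nekvinda p := exists q, nekvinda_limits p q.

(* For n > 0, R^n has infinite measure and nekvinda_limits p has at most one
   element; the default value of xget is only used when p is not nekvinda. *)
Definition nekvinda_const p : \bar R :=
  vnorm (nekvinda_exponent p (xget +oo (nekvinda_limits p))) (cst 1%R).

Definition exponent_approx p (k : nat) x : \bar R :=
  ((k%:R + 1)^-1%:E + ((k%:R - 1) / (k%:R + 1))%:E * (p x)^-1)^-1.

End variable_exponents.

Section lebesgue_box.
Context {R : realType}.

Lemma measurable_box n (A : 'I_n -> set R) : (forall i, measurable (A i)) ->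
  measurable [set x : n.-tuple R | forall i, A i (tnth x i)].
Proof.
move=> mA.
rewrite [X in measurable X](_ : _ =
    \bigcap_(i in [set: 'I_n]) (fun x : n.-tuple R => tnth x i) @^-1` A i).
  apply: fin_bigcap_measurable => [|i _]; first exact: finite_finset.
  by rewrite -[X in measurable X]setTI; exact: measurable_tnth.
by apply/seteqP; split => [x xA i _|x xA i]; exact: xA.
Qed.

Lemma borel_lebesgue_box n (A : 'I_n -> set R) :
  (forall i, measurable (A i)) ->
  borel_lebesgue R n [set x : n.-tuple R | forall i, A i (tnth x i)] =
  \prod_(i < n) (@lebesgue_measure R (A i)).
Proof.
elim: n A => [|n IH] A mA.
  rewrite big_ord0 /= /dirac indicE.
  by rewrite (_ : _ \in _) // inE => -[].
rewrite big_ord_recl /= /cons_lebesgue /pushforward.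
have -> : @tuple_cons R n @^-1` [set x : n.+1.-tuple R | forall i, A i (tnth x i)] =
    [set x : n.-tuple R | forall i, A (lift ord0 i) (tnth x i)] `*` A ord0.
  apply/seteqP; split => [[x t] /= xA|[x t] /= [xA tA] i].
    split=> [i|]; last exact: (xA ord0).
    by have := xA (lift ord0 i); rewrite tnthS.
  have [j ->|->] := unliftP ord0 i; last exact: tA.
  by rewrite tnthS; exact: xA.
rewrite product_measure1E; last 2 first.
- exact: (measurable_box (fun i => mA (lift ord0 i))).
- exact: mA.
by rewrite muleC (IH (fun i => A (lift ord0 i))) // => i; exact: mA.
Qed.

Lemma lebesgue_cube n (a : n.-tuple R) (l : R) : (0 < l)%R ->
  measurable (cube a l) /\ lebesgue (cube a l) = (l ^+ n)%:E.
Proof.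
move=> l0.
have mI (i : 'I_n) :
    measurable (`[tnth a i, (tnth a i + l)%R]%classic : set R).
  exact: measurable_itv.
have mB := measurable_box mI; have muB := borel_lebesgue_box mI.
have E : cube a l = [set x : n.-tuple R |
    forall i, (`[tnth a i, (tnth a i + l)%R]%classic : set R) (tnth x i)].
  by apply/seteqP; split => x /= xA i; have := xA i; rewrite in_itv.
rewrite E; split.
  by apply: sub_caratheodory; exact: sub_sigma_algebra.
rewrite /lebesgue /completed_measure_extension /= measurable_mu_extE // muB.
under eq_bigr => i _.
  rewrite lebesgue_measure_itv /= lte_fin ltrDl l0 -EFinD addrAC subrr add0r.
  over.
by rewrite prodEFin prodr_const card_ord.
Qed.

End lebesgue_box.

(* Main.v *)
Require Import Defs.
From mathcomp Require Import all_boot all_order all_algebra.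
From mathcomp Require Import all_classical all_reals all_analysis.
From mathcomp Require Import measurable_realfun ess_sup_inf.
From mathcomp Require Import ring lra.

(** The exponent [p_k] interpolates between [p] and the constant exponent [2]:
    [1 / p_k = th / p + (1 - th) / 2] with [th = (k - 1) / (k + 1)], so that
    [1 - th = 2 / (k + 1)] tends to [0]. As a convex combination with a positive
    weight at [1 / 2] it is finite and bounded away from [1], which gives the
    elementary bounds and the convergence of [p_k].

    The rest follows from one pointwise inequality, the convexity of [exp] along
    this interpolation ([powR_interp]):
    [(t ^ th s ^ (1 - th)) ^ r / r <= th t ^ p / p + (1 - th) s ^ 2 / 2] for
    [1 / r = th / p + (1 - th) / 2], with a separate argument where [p = +oo].

    For the Muckenhoupt condition it bounds the norm of the indicator of a cube
    [Q] for [p_k] by [2 |1_Q|_p ^ th |Q| ^ ((1 - th) / 2)], and likewise for the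
    conjugate exponent, since interpolation with [2] commutes with conjugation.
    Multiplying the two bounds, the factor [|Q| ^ (1 - th)] is absorbed by
    Hoelder's inequality [|Q| <= 2 |1_Q|_p |1_Q|_p'] at the cost of another
    factor [2], whence [8 = 2 * 2 * 2] ([vnorm_indic_interp_prod]).

    For the Nekvinda condition, the limit of [p_k] is the interpolation of the
    limit of [p], and [|1 / p_k - 1 / q_k| = th |1 / p - 1 / q|], so the
    associated exponent increases and the norm of [1] does not ([vnorm_one_le]).
    The constant is attached to a chosen limit, hence the need for the
    uniqueness of limits, where the space having infinite measure enters
    ([nekvinda_limits_unique]).

    For the modulars, taking [s = t] in the inequality and integrating bounds
    the modular for [p_k] by that for [p] plus [1 / (k + 1)] times the square
    integral of [f], which gives the upper limit; Fatou's lemma gives the lower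
    one. Since the sets defining the Luxemburg norm are upward closed and the
    modular strictly decreases along dilations, convergence of the modulars of
    all [f / l] implies that of the norms. *)

Set Implicit Arguments.
Unset Strict Implicit.
Unset Printing Implicit Defensive.

Import Order.TTheory GRing.Theory Num.Theory.
Import numFieldNormedType.Exports.

Local Open Scope classical_set_scope.
Local Open Scope ring_scope.
Local Open Scope ereal_scope.

(** * Convexity of the exponential along an interpolation of exponents *)

Section weighted_means.
Context {R : realType}.
Implicit Types (a x y t s th p r : R).

Lemma expR_convex a x y : (0 <= a <= 1)%R ->
  (expR (a * x + (1 - a) * y) <= a * expR x + (1 - a) * expR y)%R.
Proof.
move=> /andP[a0 a1].
by have := @convex_expR R (Itv01 a0 a1) x y; rewrite !convRE.
Qed.

Lemma powR_invl x a : (0 < x)%R -> ((x^-1) `^ a = (x `^ a)^-1)%R.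
Proof.
move=> x0; rewrite -powR_inv1; last exact: ltW.
by rewrite -powRrM mulN1r powRN.
Qed.

(** Convexity of [exp] between the two points [p ln t] and [2 ln s], with the
    weights [r th / p] and [r (1 - th) / 2], which add up to [1] precisely
    because of the relation defining [r]. The factor [1 / r] turns these weights
    into [th / p] and [(1 - th) / 2], which do not depend on [r]. *)
Lemma powR_interp t s th p r : (0 < t)%R -> (0 < s)%R -> (0 <= th <= 1)%R ->
  (0 < p)%R -> (0 < r)%R -> (r^-1 = (1 - th) / 2 + th / p)%R ->
  (r^-1 * (t `^ th * s `^ (1 - th)) `^ r <=
   th * (p^-1 * t `^ p) + (1 - th) / 2 * s ^+ 2)%R.
Proof.
move=> t0 s0 /andP[th0 th1] p0 r0 rE.
have rV0 : (0 < r^-1)%R by rewrite invr_gt0.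
pose a := (r * (th / p))%R.
have aE : (1 - a = r * ((1 - th) / 2))%R.
  have : (r * ((1 - th) / 2 + th / p) = 1)%R by rewrite -rE mulfV ?gt_eqF.
  by rewrite mulrDr => h; rewrite -[X in (X - a)%R]h addrK.
have a0 : (0 <= a)%R by rewrite /a mulr_ge0 ?divr_ge0// ltW.
have a1 : (a <= 1)%R.
  by rewrite -subr_ge0 aE mulr_ge0 ?divr_ge0 ?subr_ge0// ltW.
have ts0 : (0 < t `^ th * s `^ (1 - th))%R by rewrite mulr_gt0 ?powR_gt0.
have -> : ((t `^ th * s `^ (1 - th)) `^ r =
    expR (a * (p * ln t) + (1 - a) * (2 * ln s)))%R.
  rewrite {1}/powR gt_eqF// lnM ?posrE ?powR_gt0// !ln_powR; congr expR.
  by rewrite aE /a; field; rewrite gt_eqF.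
have -> : (t `^ p = expR (p * ln t))%R by rewrite /powR gt_eqF.
have -> : (s ^+ 2 = expR (2 * ln s))%R.
  by rewrite mulrC expRM lnK ?posrE// powR_mulrn// ltW.
have -> : (th * (p^-1 * expR (p * ln t)) + (1 - th) / 2 * expR (2 * ln s) =
    r^-1 * (a * expR (p * ln t) + (1 - a) * expR (2 * ln s)))%R.
  by rewrite aE /a; field; rewrite !gt_eqF.
by rewrite ler_pM2l// expR_convex// a0.
Qed.

End weighted_means.

(** * Values of exponents and of the integrands of modulars *)

Section exponent_values.
Context {R : realType}.
Implicit Types (t s th c : R) (q : \bar R).

(** The exponent whose reciprocal is the convex combination of [1 / q] and
    [1 / 2] with weights [th] and [1 - th]. *)
Definition interp th q : \bar R :=
  (((1 - th) / 2)%:E + th%:E * q^-1)^-1.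

Lemma exponent_valueP q : 1 <= q ->
  q = +oo \/ exists2 r : R, q = r%:E & (1 <= r)%R.
Proof.
by case: q => [r| |]; rewrite ?lee_fin//; [right; exists r|left].
Qed.

Lemma inve_fin r : (0 < r)%R -> (r%:E)^-1 = (r^-1)%:E :> \bar R.
Proof. by move=> r0; rewrite inver gt_eqF. Qed.

Lemma inve_exponent q : 1 <= q ->
  q^-1 = (fine q^-1)%:E /\ (0 <= fine q^-1 <= 1)%R.
Proof.
move=> /exponent_valueP[->|[r -> r1]]; first by rewrite invey /= lexx ler01.
have r0 : (0 < r)%R by exact: lt_le_trans r1.
by rewrite inve_fin//= invr_ge0 (ltW r0) invf_le1.
Qed.

(** As long as [th < 1], the weight of [1 / 2] keeps the reciprocal away from
    [0], so that the interpolated exponent is finite even where [q = +oo]. *)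
Lemma interpE th q : (0 <= th < 1)%R -> 1 <= q ->
  exists r : R, [/\ interp th q = r%:E, (1 <= r)%R &
    (r^-1 = (1 - th) / 2 + th * fine q^-1)%R].
Proof.
move=> /andP[th0 th1] /inve_exponent[qE /andP[q0 q1]].
have v0 : (0 < (1 - th) / 2 + th * fine q^-1)%R.
  by rewrite ltr_pwDl ?mulr_ge0// divr_gt0// subr_gt0.
exists ((1 - th) / 2 + th * fine q^-1)^-1%R; rewrite invrK; split=> //.
  by rewrite /interp qE -EFinM -EFinD inve_fin.
rewrite invf_ge1//; have : (th * fine q^-1 <= th)%R by rewrite ler_piMr.
lra.
Qed.

Lemma epow_ge0 t q : 0 <= epow t q.
Proof. by case: q => [r| |]//=; [rewrite lee_fin powR_ge0|case: ifP]. Qed.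

Lemma epow_div_ge0 t q : 1 <= q -> 0 <= epow_div t q.
Proof.
move=> /exponent_valueP[->|[r -> r1]] /=; first by case: ifP.
by rewrite lee_fin mulr_ge0 ?powR_ge0// invr_ge0 (le_trans _ r1).
Qed.

Lemma epow_le t c q : (0 <= t <= c)%R -> 1 <= q -> epow t q <= epow c q.
Proof.
move=> /andP[t0 tc] /exponent_valueP[->|[r -> r1]] /=.
  case: ifPn => [_|t1]; first by case: ifP.
  by rewrite ifF//; apply: contraNF t1; exact: le_trans.
have c0 := le_trans t0 tc.
by rewrite lee_fin ge0_ler_powR ?nnegrE// (le_trans _ r1).
Qed.

Lemma epow_ge_exponent t q q' : (0 < t <= 1)%R -> 1 <= q -> q <= q' ->
  epow t q' <= epow t q.
Proof.
move=> /[dup] t01 /andP[t0 t1] q1 qq'.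
have [->|[r' r'E r'1]] := exponent_valueP (le_trans q1 qq').
  by rewrite /= t1 epow_ge0.
move: q1 qq' => /exponent_valueP[->|[r -> r1]]; rewrite r'E //.
by rewrite !lee_fin => rr'; rewrite ger_powR.
Qed.

(** Since exponents are at least [1], [t ^ q] decreases at least linearly under
    contraction of [t]; at [q = +oo] this says that contracting a value in
    [0, 1] stays in [0, 1]. *)
Lemma epow_scale c t q : (0 < c <= 1)%R -> (0 <= t)%R -> 1 <= q ->
  epow (c * t) q <= c%:E * epow t q.
Proof.
move=> /[dup] c01 /andP[c0 c1] t0 /exponent_valueP[->|[r -> r1]] /=.
  case: ifPn => [|ct]; first by case: ifP => _ _; rewrite ?mule0// gt0_muley.
  rewrite ifF ?gt0_muley//; apply: contraNF ct => t1.
  by rewrite mulr_ile1// ltW.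
by rewrite -EFinM lee_fin ge1r_powRZ.
Qed.

Lemma epow_div_scale c t q : (0 < c <= 1)%R -> (0 <= t)%R -> 1 <= q ->
  epow_div (c * t) q <= c%:E * epow_div t q.
Proof.
move=> c01 t0 q1; have := epow_scale c01 t0 q1.
move: q1 => /exponent_valueP[->//|[r -> r1]] /=.
by rewrite -!EFinM !lee_fin mulrCA ler_pM2l// invr_gt0 (lt_le_trans _ r1).
Qed.

(** The case [q = +oo] of the interpolation inequalities: there
    [t ^ q < +oo] forces [t <= 1], which makes the factor [t ^ th] harmless,
    and [r (1 - th) = 2] leaves [s ^ 2]. *)
Lemma epow_interp_infty t s th r : (0 < t <= 1)%R -> (0 < s)%R ->
  (0 <= th < 1)%R -> (0 < r)%R -> (r^-1 = (1 - th) / 2)%R ->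
  ((t `^ th * s `^ (1 - th)) `^ r <= s ^+ 2)%R.
Proof.
move=> t01 s0 /andP[th0 th1] r0 rE.
have -> : (s ^+ 2 = (s `^ (1 - th)) `^ r)%R.
  rewrite -powRrM -powR_mulrn ?ltW//; congr powR.
  by rewrite -[r]invrK rE; field; rewrite subr_eq0 gt_eqF.
rewrite ge0_ler_powR ?nnegrE ?mulr_ge0 ?powR_ge0 ?(ltW r0)//.
rewrite ler_piMl ?powR_ge0//.
by have := ger_powR t01 th0; rewrite powRr0.
Qed.

(** Pointwise form of the interpolation of norms: if the modular of [f] for
    [p] and that of [g] for the exponent [2] are at most [1], integrating this
    bounds the modular of [f ^ th g ^ (1 - th)] for the interpolated exponent
    by [2]. *)
Lemma epow_interp t s th q : (0 < t)%R -> (0 < s)%R -> (0 <= th < 1)%R ->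
  1 <= q ->
  epow (t `^ th * s `^ (1 - th)) (interp th q) <= epow t q + (s ^+ 2)%:E.
Proof.
move=> t0 s0 th01 q1; have [r [-> r1 rE]] := interpE th01 q1.
have r0 : (0 < r)%R by exact: lt_le_trans r1.
have /andP[th0 th1] := th01.
move: q1 rE => /exponent_valueP[->|[p -> p1]] /=.
  rewrite ?invey /= mulr0 addr0 => rE.
  case: ifPn => [t1|_]; last by rewrite leey.
  by rewrite add0e lee_fin (@epow_interp_infty _ _ th)// t0.
have p0 : (0 < p)%R by exact: lt_le_trans p1.
rewrite inve_fin//= => rE; rewrite -EFinD lee_fin.
have th01' : (0 <= th <= 1)%R by rewrite th0 ltW.
have := powR_interp t0 s0 th01' p0 r0 rE.
rewrite mulrC ler_pdivrMr// => /le_trans; apply.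
have rVr : (r^-1 * r = 1)%R by rewrite mulVf ?gt_eqF.
have ap : (th / p * r <= 1)%R.
  by rewrite -[leRHS]rVr ler_pM2r// rE lerDr divr_ge0// subr_ge0 ltW.
have bp : ((1 - th) / 2 * r <= 1)%R.
  by rewrite -[leRHS]rVr ler_pM2r// rE lerDl divr_ge0// ltW.
rewrite mulrDl lerD//.
  by rewrite mulrA mulrAC ler_piMl ?powR_ge0.
by rewrite mulrAC ler_piMl ?sqr_ge0.
Qed.

(** The case [s = t] of the interpolation inequality. Here the coefficient of
    [t ^ 2] has to be kept: it tends to [0] as [th] tends to [1]. *)
Lemma epow_div_interp t th q : (0 <= t)%R -> (0 <= th < 1)%R -> 1 <= q ->
  epow_div t (interp th q) <= epow_div t q + ((1 - th) / 2 * t ^+ 2)%:E.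
Proof.
move=> t0 th01 q1; have [r [-> r1 rE]] := interpE th01 q1.
have r0 : (0 < r)%R by exact: lt_le_trans r1.
have /andP[th0 th1] := th01.
have th01' : (0 <= th <= 1)%R by rewrite th0 ltW.
have [t_gt0|] := ltrP 0%R t; last first.
  move=> t_le0; have -> : t = 0%R by apply/eqP; rewrite eq_le t0 t_le0.
  by rewrite /= powR0 ?gt_eqF// mulr0 expr0n/= mulr0 adde0 epow_div_ge0.
have tE : (t = t `^ th * t `^ (1 - th))%R.
  rewrite -powRD ?subrKC ?powRr1//.
  by apply/implyP => _; rewrite gt_eqF.
move: q1 rE => /exponent_valueP[->|[p -> p1]] /=.
  rewrite ?invey /= mulr0 addr0 => rE.
  case: ifPn => [t1|_]; last by rewrite leey.
  rewrite add0e lee_fin rE ler_pM2l ?divr_gt0 ?subr_gt0//.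
  by rewrite {1}tE (@epow_interp_infty _ _ th)// t_gt0.
have p0 : (0 < p)%R by exact: lt_le_trans p1.
rewrite inve_fin//= => rE; rewrite -EFinD lee_fin.
have := powR_interp t_gt0 t_gt0 th01' p0 r0 rE.
rewrite -tE => /le_trans; apply.
rewrite lerD2r ler_piMl ?(ltW th1)//.
by rewrite mulr_ge0 ?powR_ge0// invr_ge0 ltW.
Qed.

(** Young's inequality for a pair of conjugate exponents; at the endpoints
    [1] and [+oo] one of the two terms is infinite unless its base is at most
    [1]. *)
Lemma young_epow t s q : (0 <= t)%R -> (0 <= s)%R -> 1 <= q ->
  (t * s)%:E <= epow t q + epow s (1 - q^-1)^-1.
Proof.
move=> t0 s0 /exponent_valueP[->|[r -> r1]].
  rewrite invey oppe0 adde0 inve1 /= powRr1//.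
  case: ifPn => [t1|_]; last by rewrite leey.
  by rewrite add0e lee_fin ler_piMl.
have r0 : (0 < r)%R by exact: lt_le_trans r1.
rewrite inve_fin// -EFinB.
have [r11|rn1] := eqVneq r 1%R.
  rewrite r11 invr1 subrr inve0 /= powRr1//.
  case: ifPn => [s1|_]; last by rewrite leey.
  by rewrite adde0 lee_fin ler_piMr.
have r_gt1 : (1 < r)%R by rewrite lt_neqAle eq_sym rn1.
have rV1 : (r^-1 < 1)%R by rewrite invf_lt1.
have r'0 : (0 < (1 - r^-1)^-1)%R by rewrite invr_gt0 subr_gt0.
rewrite inve_fin ?subr_gt0//= -EFinD lee_fin.
apply: le_trans (conjugate_powR t0 s0 r0 r'0 _) _.
  by rewrite invrK subrKC.
rewrite invrK lerD// ler_piMr ?powR_ge0// ?(ltW rV1)//.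
by rewrite gerBl invr_ge0 ltW.
Qed.

Lemma interp_ge_min th q : (0 <= th < 1)%R -> 1 <= q ->
  mine q 2%:E <= interp th q.
Proof.
move=> th01 q1; have [r [-> r1 rE]] := interpE th01 q1.
have r0 : (0 < r)%R by exact: lt_le_trans r1.
have /andP[th0 th1] := th01.
rewrite ge_min; have [//|/= rq] := leP q r%:E.
rewrite lee_fin leNgt; apply/negP => r2.
have := rE; apply/eqP; rewrite gt_eqF//.
have r2V : (2^-1 < r^-1)%R by rewrite ltf_pV2 ?posrE.
have qr : (fine q^-1 < r^-1)%R.
  move: q1 rq {rE} => /exponent_valueP[->|[p -> p1]].
    by rewrite invey invr_gt0.
  have p0 := lt_le_trans ltr01 p1.
  by rewrite lte_fin inve_fin//= => ?; rewrite ltf_pV2 ?posrE.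
have := ler_wpM2l th0 (ltW qr).
have : ((1 - th) * 2^-1 < (1 - th) * r^-1)%R by rewrite ltr_pM2l// subr_gt0.
lra.
Qed.

Lemma interp_le_max th q : (0 <= th < 1)%R -> 1 <= q ->
  interp th q <= maxe q 2%:E.
Proof.
move=> th01 q1; have [r [-> r1 rE]] := interpE th01 q1.
have r0 : (0 < r)%R by exact: lt_le_trans r1.
have /andP[th0 th1] := th01.
rewrite le_max; have [//|/= rq] := leP r%:E q.
rewrite lee_fin leNgt; apply/negP => r2.
have := rE; apply/eqP; rewrite lt_eqF//.
have r2V : (r^-1 < 2^-1)%R by rewrite ltf_pV2 ?posrE.
have qr : (r^-1 < fine q^-1)%R.
  move: q1 rq {rE} => /exponent_valueP[->//|[p -> p1]].
  have p0 := lt_le_trans ltr01 p1.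
  by rewrite lte_fin inve_fin//= => ?; rewrite ltf_pV2 ?posrE.
have := ler_wpM2l th0 (ltW qr).
have : ((1 - th) * r^-1 < (1 - th) * 2^-1)%R by rewrite ltr_pM2l// subr_gt0.
lra.
Qed.

End exponent_values.

(** * Measurability and closure properties of variable exponents *)

Section measurability.
Context d (T : measurableType d) (R : realType).
Implicit Types (f g : T -> R) (q : T -> \bar R).

(** Measurability when both the base and the exponent vary, which is what the
    integrand of a modular requires. *)
Lemma measurable_fun_powR2 f g : measurable_fun setT f ->
  measurable_fun setT g -> measurable_fun setT (fun x => f x `^ g x)%R.
Proof.
move=> mf mg; rewrite /powR; apply: measurable_fun_ifT.
- by apply: measurable_fun_eqr => //; exact: measurable_cst.
- rewrite (_ : (fun _ => _) = fun x => if g x == 0%R then 1%R else 0%R).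
    apply: measurable_fun_ifT; [|exact: measurable_cst..].
    by apply: measurable_fun_eqr => //; exact: measurable_cst.
  by apply/funext => x; case: (g x == 0%R).
- apply: measurableT_comp => //; apply: measurable_funM => //.
  exact: measurableT_comp.
Qed.

Lemma measurable_fun_eqe q (c : \bar R) : measurable_fun setT q ->
  measurable_fun setT (fun x => q x == c).
Proof.
move=> mq; apply: (measurable_fun_bool false); rewrite setTI.
rewrite [X in measurable X](_ : _ = [set: T] `&` [set x | q x != c]).
  exact: emeasurable_neq.
by rewrite setTI; apply/seteqP; split=> x /=; [move=> ->|move/negbTE].
Qed.

Lemma measurable_fun_fine q : measurable_fun setT q ->
  measurable_fun setT (fun x => fine (q x)).
Proof.
by move=> mq; apply: (measurableT_comp _ mq); exact: fine_measurable.
Qed.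

Lemma measurable_fun_inve q : (forall x, 0 <= q x) -> measurable_fun setT q ->
  measurable_fun setT (fun x => (q x)^-1).
Proof.
move=> q0 mq; rewrite (_ : (fun _ => _) = fun x =>
    if q x == 0 then +oo else (fine (q x) `^ (-1))%:E); last first.
  apply/funext => x; move: (q0 x); case: (q x) => [r| |]//=.
    rewrite lee_fin eqe inver => r0; case: ifP => // _.
    by rewrite powR_inv1.
  by move=> _; rewrite invey powR0// oppr_eq0 oner_eq0.
apply: measurable_fun_ifT; first exact: measurable_fun_eqe.
  exact: measurable_cst.
apply/measurable_EFinP; apply: measurable_fun_powR2.
  exact: measurable_fun_fine.
exact: measurable_cst.
Qed.

Lemma measurable_fun_epow f q : measurable_fun setT f ->
  measurable_fun setT q -> (forall x, 1 <= q x) ->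
  measurable_fun setT (fun x => epow (f x) (q x)).
Proof.
move=> mf mq q1; rewrite (_ : (fun _ => _) = fun x =>
    if q x == +oo then (if (f x <= 1)%R then 0 else +oo)
    else (f x `^ fine (q x))%:E); last first.
  by apply/funext => x; have [->|[r -> _]] := exponent_valueP (q1 x).
apply: measurable_fun_ifT; first exact: measurable_fun_eqe.
  apply: measurable_fun_ifT; [|exact: measurable_cst..].
  by apply: measurable_fun_ler => //; exact: measurable_cst.
apply/measurable_EFinP; apply: measurable_fun_powR2 => //.
exact: measurable_fun_fine.
Qed.

Lemma measurable_fun_epow_div f q : measurable_fun setT f ->
  measurable_fun setT q -> (forall x, 1 <= q x) ->
  measurable_fun setT (fun x => epow_div (f x) (q x)).
Proof.
move=> mf mq q1; rewrite (_ : (fun _ => _) = fun x =>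
    (if q x == +oo then 1 else (q x)^-1) * epow (f x) (q x)); last first.
  apply/funext => x; have [->|[r -> r1]] := exponent_valueP (q1 x).
    by rewrite eqxx mul1e.
  by rewrite /= inve_fin// (lt_le_trans _ r1).
apply: emeasurable_funM; last exact: measurable_fun_epow.
apply: measurable_fun_ifT; first exact: measurable_fun_eqe.
  exact: measurable_cst.
by apply: measurable_fun_inve => // x; exact: le_trans (q1 x).
Qed.

Lemma ge0_le_integralT (mu : {measure set T -> \bar R}) (F G : T -> \bar R) :
  (forall x, 0 <= F x) -> measurable_fun setT F -> measurable_fun setT G ->
  (forall x, F x <= G x) -> \int[mu]_x F x <= \int[mu]_x G x.
Proof.
by move=> F0 mF mG FG; apply: ge0_le_integral => // x _; exact: FG.
Qed.

Lemma ge0_integralDT (mu : {measure set T -> \bar R}) (F G : T -> \bar R) :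
  (forall x, 0 <= F x) -> measurable_fun setT F ->
  (forall x, 0 <= G x) -> measurable_fun setT G ->
  \int[mu]_x (F x + G x) = \int[mu]_x F x + \int[mu]_x G x.
Proof.
by move=> F0 mF G0 mG; apply: ge0_integralD => // x _; rewrite ?F0 ?G0.
Qed.

Lemma ge0_integralZlT (mu : {measure set T -> \bar R}) (F : T -> \bar R)
    (c : R) : (0 <= c)%R -> (forall x, 0 <= F x) -> measurable_fun setT F ->
  \int[mu]_x (c%:E * F x) = c%:E * \int[mu]_x F x.
Proof. by move=> c0 F0 mF; apply: ge0_integralZl_EFin => // x _; exact: F0. Qed.

End measurability.

Section exponents.
Context {R : realType} {n : nat}.
Local Notation mu := (@lebesgue R n).
Implicit Types (p : Rn R n -> \bar R) (f : Rn R n -> R).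

Lemma exponent_interp p th : (0 <= th < 1)%R -> exponent p ->
  exponent (fun x => interp th (p x)).
Proof.
move=> th01 [mp p1]; split=> [|x]; last first.
  by have [r [-> r1 _]] := interpE th01 (p1 x); rewrite lee_fin.
have /andP[th0 th1] := th01.
apply: measurable_fun_inve => [x|].
  rewrite adde_ge0 ?lee_fin ?divr_ge0 ?subr_ge0 ?(ltW th1)//.
  by rewrite mule_ge0// inve_ge0 (le_trans _ (p1 x)).
apply: emeasurable_funD; first exact: measurable_cst.
apply: measurable_funeM; apply: measurable_fun_inve => // x.
exact: le_trans (p1 x).
Qed.

Lemma conjugateE p x : 1 <= p x ->
  conjugate p x = ((1 - fine (p x)^-1)%R%:E)^-1.
Proof. by move=> /inve_exponent[e _]; rewrite /conjugate {1}e. Qed.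

Lemma exponent_conjugate p : exponent p -> exponent (conjugate p).
Proof.
move=> [mp p1]; have p0 x : 0 <= p x by exact: le_trans (p1 x).
have c01 x : 0 <= 1 - (p x)^-1 <= 1.
  have [-> /andP[v0 v1]] := inve_exponent (p1 x).
  by rewrite -EFinB !lee_fin subr_ge0 v1 gerBl.
split=> [|x].
  apply: measurable_fun_inve => [x|]; first by have /andP[] := c01 x.
  apply: emeasurable_funB; first exact: measurable_cst.
  exact: measurable_fun_inve.
by have /andP[c0 c1] := c01 x; rewrite inve_ge1.
Qed.

(** Interpolation with [2] commutes with conjugation because [2] is its own
    conjugate. *)
Lemma conjugate_interp p th : (0 <= th < 1)%R -> exponent p ->
  conjugate (fun x => interp th (p x)) = fun x => interp th (conjugate p x).
Proof.
move=> th01 [_ p1]; apply/funext => x.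
have [r [rE r1 rV]] := interpE th01 (p1 x).
rewrite conjugateE rE ?lee_fin// /interp (conjugateE (p1 x)) inveK.
rewrite (inve_fin (lt_le_trans ltr01 r1)) /= rV -EFinM -EFinD.
congr (inve (EFin _)); move: (fine _) => u; lra.
Qed.

Lemma exponent_nekvinda p (q : \bar R) : 1 <= q -> exponent p ->
  exponent (nekvinda_exponent p q).
Proof.
move=> q1 [mp p1]; have p0 x : 0 <= p x by exact: le_trans (p1 x).
split=> [|x].
  apply: measurable_fun_inve => [x|]; first exact: abse_ge0.
  apply: (measurableT_comp (@abse_measurable R setT)).
  apply: emeasurable_funB; first exact: measurable_fun_inve p0 mp.
  exact: measurable_cst.
rewrite /nekvinda_exponent inve_ge1//.
have [-> /andP[u0 u1]] := inve_exponent (p1 x).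
have [-> /andP[v0 v1]] := inve_exponent q1.
by rewrite -EFinB lee_fin ler_norml; apply/andP; split; lra.
Qed.

Lemma luxemburg_le (rho : (Rn R n -> R) -> \bar R) f (l : R) : (0 < l)%R ->
  rho (fun x => f x / l)%R <= 1 -> luxemburg rho f <= l%:E.
Proof. by move=> l0 rl; apply: ereal_inf_lbound; exists l. Qed.

Lemma le_luxemburg (rho : (Rn R n -> R) -> \bar R) f (y : \bar R) :
  (forall l, (0 < l)%R -> rho (fun x => f x / l)%R <= 1 -> y <= l%:E) ->
  y <= luxemburg rho f.
Proof.
by move=> yl; apply: le_ereal_inf_tmp => _ [l [l0 rl] <-]; exact: yl.
Qed.

Lemma luxemburg_ge0 (rho : (Rn R n -> R) -> \bar R) f : 0 <= luxemburg rho f.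
Proof. by apply: le_luxemburg => l l0 _; rewrite lee_fin ltW. Qed.

Lemma measurable_modular p f : exponent p -> measurable_fun setT f ->
  measurable_fun setT (fun x => epow `|f x| (p x)).
Proof.
move=> [mp p1] mf; apply: measurable_fun_epow mp p1.
exact: (measurableT_comp (@normr_measurable R setT) mf).
Qed.

Lemma measurable_modular_tilde p f : exponent p -> measurable_fun setT f ->
  measurable_fun setT (fun x => epow_div `|f x| (p x)).
Proof.
move=> [mp p1] mf; apply: measurable_fun_epow_div mp p1.
exact: (measurableT_comp (@normr_measurable R setT) mf).
Qed.

Lemma measurable_fun_divr f (l : R) : measurable_fun setT f ->
  measurable_fun setT (fun x => f x / l)%R.
Proof. by move=> mf; apply: measurable_funM => //; exact: measurable_cst. Qed.

End exponents.

(** * The approximating exponents *)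

Section approximations.
Context {R : realType} {n : nat}.
Local Notation mu := (@lebesgue R n).
Implicit Types (p : Rn R n -> \bar R).

(** With this [th], the weight [(1 - th) / 2] of the interpolation is
    [1 / (k + 1)]. *)
Definition weight (k : nat) : R := ((k%:R - 1) / (k%:R + 1))%R.

Lemma half_onem_weight k : ((1 - weight k) / 2 = (k%:R + 1)^-1)%R.
Proof. by rewrite /weight; field; rewrite natr1 pnatr_eq0. Qed.

Lemma weight_lt1 k : (0 < k)%N -> (0 <= weight k < 1)%R.
Proof.
move=> k0; have k1 : (0 < k%:R + 1 :> R)%R by rewrite natr1 ltr0n.
rewrite /weight divr_ge0 ?(ltW k1) ?subr_ge0 ?ler1n//=.
by rewrite ltr_pdivrMr// mul1r; lra.
Qed.

Lemma exponent_approxE p k :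
  exponent_approx p k = fun x => interp (weight k) (p x).
Proof. by apply/funext => x; rewrite /interp half_onem_weight. Qed.

Lemma exponent_approx_fin p k x : (0 < k)%N -> 1 <= p x ->
  exists r : R, [/\ exponent_approx p k x = r%:E, (1 <= r)%R &
    (r^-1 = (k%:R + 1)^-1 + weight k * fine (p x)^-1)%R].
Proof.
move=> k0 px1; rewrite exponent_approxE -half_onem_weight.
exact: interpE (weight_lt1 k0) px1.
Qed.

Lemma exponent_approx_exponent p k : exponent p -> (0 < k)%N ->
  exponent (exponent_approx p k).
Proof.
move=> hp k0; rewrite exponent_approxE.
exact: exponent_interp (weight_lt1 k0) hp.
Qed.

(** The difference is [(2 u - 1) / (k + 1)] with [u = 1 / p x] in [0, 1]. *)
Lemma exponent_approx_dist p k x : (0 < k)%N -> 1 <= p x ->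
  (`|fine (p x)^-1 - fine (exponent_approx p k x)^-1| <= (k%:R + 1)^-1)%R.
Proof.
move=> k0 px1; have [r [-> r1 rE]] := exponent_approx_fin k0 px1.
rewrite (inve_fin (lt_le_trans ltr01 r1)) /= rE.
have [_ /andP[]] := inve_exponent px1.
move: (fine _) => u u0 u1; have k1 : (0 < k%:R + 1 :> R)%R by rewrite natr1.
have -> : (u - ((k%:R + 1)^-1 + weight k * u) = (k%:R + 1)^-1 * (2 * u - 1))%R.
  by rewrite /weight; field; rewrite gt_eqF.
rewrite normrM ger0_norm ?invr_ge0 ?(ltW k1)// ler_piMr ?invr_ge0 ?(ltW k1)//.
by rewrite ler_norml; apply/andP; split; lra.
Qed.

Lemma exponent_approx_inv_cvg p : exponent p ->
  {uniform [set: Rn R n],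
    (fun (k : nat) (x : Rn R n) => fine (exponent_approx p k x)^-1) @ \oo -->
    (fun x : Rn R n => fine (p x)^-1)}.
Proof.
move=> [_ p1] U /uniform_nbhs[E [entE EU]].
have [e /= e0 eE] := entE.
rewrite nbhs_simpl /=; near=> k; apply: EU => x _ /=; apply: eE => /=.
rewrite /ball /=; apply: le_lt_trans (exponent_approx_dist _ (p1 x)) _.
  by near: k; exact: nbhs_infty_gt.
by rewrite natr1; near: k; exact: (near_infty_natSinv_lt (PosNum e0)).
Unshelve. all: by end_near. Qed.

(** At a point with [p x = +oo] the approximation is the number [k + 1] itself;
    elsewhere the reciprocals converge to a nonzero number and can be
    inverted. *)
Lemma exponent_approx_cvg p x : 1 <= p x ->
  exponent_approx p k x @[k --> \oo] --> p x.
Proof.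
move=> px1; have [pxy|[r pxr r1]] := exponent_valueP px1.
  rewrite pxy; apply/cvgeyPge => A; near=> k.
  have k0 : (0 < k)%N by near: k; exact: nbhs_infty_gt.
  have [s [-> s1]] := exponent_approx_fin k0 px1.
  rewrite pxy invey mulr0 addr0 => /invr_inj ->; rewrite lee_fin.
  rewrite ler_wpDr//; near: k; exact: nbhs_infty_ger.
have r0 : (0 < r)%R by exact: lt_le_trans r1.
(* The reciprocals are the quantities known to converge. *)
have approx_fin k : (0 < k)%N ->
    exponent_approx p k x = (fine (exponent_approx p k x)^-1)^-1%:E.
  move=> k0; have [s [-> s1 _]] := exponent_approx_fin k0 px1.
  by rewrite (inve_fin (lt_le_trans ltr01 s1)) /= invrK.
rewrite pxr; apply: cvg_EFin.
  by near=> k; rewrite approx_fin//; near: k; exact: nbhs_infty_gt.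
rewrite -[r]invrK.
have h : fine (exponent_approx p k x)^-1 @[k --> \oo] --> (r^-1)%R.
  apply/cvgrPdist_le => e e0; near=> k.
  have := @exponent_approx_dist p k x; rewrite pxr inve_fin//=.
  move=> /(_ _ _)/le_trans; apply; rewrite ?lee_fin//.
    by near: k; exact: nbhs_infty_gt.
  apply: ltW; rewrite natr1; near: k.
  exact: (near_infty_natSinv_lt (PosNum e0)).
have rV0 : (r^-1 != 0)%R by rewrite invr_neq0// gt_eqF.
apply: cvg_trans (cvgV rV0 h); apply: near_eq_cvg; near=> k.
by rewrite /= [in RHS]approx_fin//; near: k; exact: nbhs_infty_gt.
Unshelve. all: by end_near. Qed.

Lemma exponent_approx_bounds p k x : (0 < k)%N -> 1 <= p x ->
  (1 + k%:R^-1)%:E <= exponent_approx p k x <= (k%:R + 1)%:E.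
Proof.
move=> k0 px1; have [r [-> r1 rE]] := exponent_approx_fin k0 px1.
have r0 : (0 < r)%R by exact: lt_le_trans r1.
have kR : (0 < k%:R :> R)%R by rewrite ltr0n.
have k1 : (0 < k%:R + 1 :> R)%R by rewrite natr1.
have [_ /andP[u0 u1]] := inve_exponent px1.
have /andP[w0 w1] := weight_lt1 k0.
rewrite !lee_fin; apply/andP; split.
  rewrite -[leRHS]invrK -[leLHS]invrK.
  rewrite lef_pV2 ?posrE ?invr_gt0 ?addr_gt0 ?invr_gt0//.
  have -> : ((1 + k%:R^-1)^-1 = (k%:R + 1)^-1 + weight k :> R)%R.
    by rewrite /weight; field; rewrite !gt_eqF.
  by rewrite rE lerD2l ler_piMr.
rewrite -[leRHS]invrK -[leLHS]invrK lef_pV2 ?posrE ?invr_gt0//.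
by rewrite rE lerDl mulr_ge0.
Qed.

Lemma ess_inf_le_sup p : 0 < mu setT -> ess_inf mu p <= ess_sup mu p.
Proof.
move=> mu0; rewrite -(ess_sup_cst (mu := mu) (ess_inf mu p) mu0).
by apply: le_ess_sup; exact: ess_inf_le.
Qed.

Lemma ess_bounds_exponent_approx p k : 0 < mu setT -> exponent p -> (0 < k)%N ->
  [/\ (1 + k%:R^-1)%:E <= ess_inf mu (exponent_approx p k),
      ess_inf mu (exponent_approx p k) <= ess_sup mu (exponent_approx p k),
      ess_sup mu (exponent_approx p k) <= (k%:R + 1)%:E,
      Order.min (ess_inf mu p) 2%:E <= ess_inf mu (exponent_approx p k) &
      ess_sup mu (exponent_approx p k) <= Order.max (ess_sup mu p) 2%:E].
Proof.
move=> mu0 [_ p1] k0; split.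
- by apply/ess_infP/aeW => x; have /andP[] := exponent_approx_bounds k0 (p1 x).
- exact: ess_inf_le_sup.
- by apply/ess_supP/aeW => x; have /andP[] := exponent_approx_bounds k0 (p1 x).
- apply/ess_infP; apply: filterS (ess_inf_le mu p) => x px.
  rewrite exponent_approxE.
  apply: le_trans (interp_ge_min (weight_lt1 k0) (p1 x)).
  by rewrite le_min !ge_min px lexx orbT.
- apply/ess_supP; apply: filterS (ess_sup_ge mu p) => x px.
  rewrite exponent_approxE.
  apply: (le_trans (interp_le_max (weight_lt1 k0) (p1 x))).
  by rewrite ge_max !le_max px lexx orbT.
Qed.

End approximations.

(** * Interpolation of the Muckenhoupt condition *)

Section muckenhoupt_interpolation.
Context {R : realType} {n : nat}.
Local Notation mu := (@lebesgue R n).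
Variables (Q : set (Rn R n)) (V : R).
Hypotheses (mQ : measurable Q) (QV : mu Q = V%:E) (V0 : (0 < V)%R).
Implicit Types (p : Rn R n -> \bar R) (l m th c : R).

Lemma measurable_fun_indic_div l :
  measurable_fun setT (fun x : Rn R n => \1_Q x / l)%R.
Proof. by apply: measurable_fun_divr; exact: measurable_indic. Qed.

Lemma integral_indic_scale c : (0 <= c)%R ->
  \int[mu]_x (c * \1_Q x)%:E = (c * V)%:E.
Proof.
move=> c0; under eq_integral do rewrite EFinM.
have m1 : measurable_fun setT (fun x : Rn R n => (\1_Q x : R)%:E).
  by apply/measurable_EFinP; exact: measurable_indic.
have Q0 (x : Rn R n) : 0 <= (\1_Q x : R)%:E by rewrite lee_fin.
rewrite (ge0_integralZlT _ c0 Q0 m1).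
by rewrite integral_indic// setIT (EFinM c) -QV.
Qed.

Lemma measurable_indic_scale c :
  measurable_fun setT (fun x : Rn R n => (c * \1_Q x)%:E).
Proof.
apply/measurable_EFinP; apply: measurable_funM; first exact: measurable_cst.
exact: measurable_indic.
Qed.

(** Interpolation between the norm for [p] and the norm for [2] of the
    indicator of [Q], the latter being the square root of [V]. Any [l]
    admissible for [p] gives an admissible number for the interpolated exponent,
    the factor [2] absorbing the sum of the two modulars. *)
Lemma vnorm_indic_interp p th l : exponent p -> (0 <= th < 1)%R -> (0 < l)%R ->
  modular p (fun x => \1_Q x / l)%R <= 1 ->
  vnorm (fun x => interp th (p x)) \1_Q <=
    (2 * (l `^ th * (V `^ 2^-1) `^ (1 - th)))%:E.
Proof.
move=> hp th01 l0 pl1.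
have [mp p1] := hp; have ip := exponent_interp th01 hp; have [_ ip1] := ip.
set s := (V `^ 2^-1)%R; have s0 : (0 < s)%R by rewrite powR_gt0.
have ls0 : (0 < l `^ th * s `^ (1 - th))%R by rewrite mulr_gt0 ?powR_gt0.
apply: luxemburg_le; first by rewrite mulr_gt0.
have half01 : (0 < (2^-1 : R) <= 1)%R by lra.
have pQ x : epow `|\1_Q x / (2 * (l `^ th * s `^ (1 - th)))|%R (interp th (p x))
    <= 2^-1%:E * (epow `|\1_Q x / l|%R (p x) + (V^-1 * \1_Q x)%:E).
  rewrite indicE; case: (x \in Q) => /=; last first.
    have [r [-> r1 _]] := interpE th01 (p1 x).
    rewrite mul0r normr0 /= powR0 ?gt_eqF ?(lt_le_trans _ r1)//.
    by rewrite mulr0 adde0 mule_ge0 ?epow_ge0.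
  rewrite !mul1r mulr1 !ger0_norm ?invr_ge0 ?mulr_ge0 ?powR_ge0 ?(ltW l0)//.
  rewrite invfM; apply: le_trans (epow_scale half01 _ (ip1 x)) _.
    by rewrite invr_ge0 ltW.
  rewrite lee_pmul2l//.
  have -> : ((l `^ th * s `^ (1 - th))^-1 =
      (l^-1) `^ th * (s^-1) `^ (1 - th))%R.
    by rewrite invfM !powR_invl.
  have -> : (V^-1 = s^-1 ^+ 2)%R.
    by rewrite exprVn -powR_mulrn ?powR_ge0// -powRrM mulVf// powRr1// ltW.
  by apply: epow_interp; rewrite ?invr_gt0.
have mpl := measurable_modular hp (measurable_fun_indic_div l).
have mV := measurable_indic_scale V^-1.
rewrite /modular; apply: (@le_trans _ _
    (\int[mu]_x (2^-1%:E * (epow `|\1_Q x / l|%R (p x) + (V^-1 * \1_Q x)%:E)))).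
  apply: ge0_le_integralT pQ.
  - by move=> x; exact: epow_ge0.
  - exact: measurable_modular ip (measurable_fun_indic_div _).
  - by apply: measurable_funeM; exact: emeasurable_funD mpl mV.
have V1 : (0 <= V^-1)%R by rewrite invr_ge0 ltW.
have V1Q x : 0 <= (V^-1 * \1_Q x)%:E by rewrite lee_fin mulr_ge0.
have plV0 x : 0 <= epow `|\1_Q x / l|%R (p x) + (V^-1 * \1_Q x)%:E.
  by rewrite adde_ge0 ?epow_ge0.
rewrite (ge0_integralZlT _ _ plV0 (emeasurable_funD mpl mV)); last by [].
rewrite (ge0_integralDT _ _ mpl V1Q mV); last by move=> x; exact: epow_ge0.
rewrite integral_indic_scale// mulVf ?gt_eqF//.
(* Each of the two modulars contributes at most 1. *)
rewrite -[leRHS](_ : 2^-1%:E * (1 + 1) = 1).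
  by rewrite lee_pmul2l// leeD2r.
by rewrite -EFinD -EFinM; congr EFin; lra.
Qed.

(** Hoelder's inequality for the product of the indicator of [Q] with
    itself: integrate Young's inequality for [1 / l] and [1 / m]. *)
Lemma indic_holder p l m : exponent p -> (0 < l)%R -> (0 < m)%R ->
  modular p (fun x => \1_Q x / l)%R <= 1 ->
  modular (conjugate p) (fun x => \1_Q x / m)%R <= 1 ->
  (V <= 2 * (l * m))%R.
Proof.
move=> hp l0 m0 pl1 pm1; have hp' := exponent_conjugate hp.
have [mp p1] := hp.
have lm0 : (0 < l * m)%R by rewrite mulr_gt0.
rewrite -ler_pdivrMr// -lee_fin mulrC -integral_indic_scale; last first.
  by rewrite invr_ge0 ltW.
have mpl := measurable_modular hp (measurable_fun_indic_div l).
have mpm := measurable_modular hp' (measurable_fun_indic_div m).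
have -> : 2%:E = 1 + 1 :> \bar R by rewrite -EFinD.
apply: le_trans (leeD pl1 pm1).
rewrite /modular -(ge0_integralDT _ _ mpl _ mpm); last 2 first.
- by move=> x; exact: epow_ge0.
- by move=> x; exact: epow_ge0.
apply: ge0_le_integralT.
- by move=> x; rewrite lee_fin mulr_ge0// invr_ge0 ltW.
- exact: measurable_indic_scale.
- exact: emeasurable_funD mpl mpm.
move=> x; have := young_epow (normr_ge0 (\1_Q x / l)%R)
  (normr_ge0 (\1_Q x / m)%R) (p1 x).
apply: le_trans; rewrite lee_fin -normrM ger0_norm; last first.
  by rewrite mulr_ge0 ?divr_ge0// ltW.
by rewrite mulrACA indicE -natrM mulnb andbb invfM mulrC.
Qed.

(** For [l >= 1] the integrand is at most [1 / l] on [Q], so [l >= V] suffices.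
    This makes the norms of indicators finite, without which passing to the
    infimum in a product of norms could meet [0 * +oo]. *)
Lemma modular_indic_bounded p : exponent p -> exists2 l,
  (0 < l)%R & modular p (fun x => \1_Q x / l)%R <= 1.
Proof.
move=> hp; have [mp p1] := hp.
pose l := Num.max 1%R V; exists l; first by rewrite lt_max ltr01.
have l1 : (1 <= l)%R by rewrite le_max lexx.
have l0 : (0 < l)%R by exact: lt_le_trans l1.
have lV0 : (0 <= l^-1)%R by rewrite invr_ge0 ltW.
apply: (@le_trans _ _ (\int[mu]_x (l^-1 * \1_Q x)%:E)).
  apply: ge0_le_integralT.
  - by move=> x; exact: epow_ge0.
  - exact: measurable_modular hp (measurable_fun_indic_div l).
  - exact: measurable_indic_scale.
  move=> x; rewrite indicE; case: (x \in Q) => /=; last first.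
    rewrite mul0r normr0 mulr0.
    have [->|[r -> r1]] := exponent_valueP (p1 x); first by rewrite /= ler01.
    by rewrite /= powR0// gt_eqF// (lt_le_trans _ r1).
  rewrite mul1r mulr1 ger0_norm//.
  have lV1 : (l^-1 <= 1)%R by rewrite invf_le1.
  have [->|[r -> r1]] := exponent_valueP (p1 x); first by rewrite /= lV1.
  by rewrite lee_fin ge1r_powR// invr_gt0 l0.
rewrite integral_indic_scale// lee_fin mulrC ler_pdivrMr// mul1r.
by rewrite le_max lexx orbT.
Qed.

(** For [l] and [m] admissible for [p] and its conjugate, the left-hand side
    is at most [4 (l m) ^ th V ^ (1 - th)]. Hoelder's bound [V <= 2 l m] turns
    this into [4 * 2 ^ (1 - th) l m <= 8 l m]. *)
Lemma vnorm_indic_interp_prod p th : exponent p -> (0 <= th < 1)%R ->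
  vnorm (fun x => interp th (p x)) \1_Q *
    vnorm (conjugate (fun x => interp th (p x))) \1_Q <=
  8%:E * (vnorm p \1_Q * vnorm (conjugate p) \1_Q).
Proof.
move=> hp th01; have hp' := exponent_conjugate hp.
rewrite conjugate_interp//; set N := (X in X <= _).
have /andP[th0 th1] := th01.
have key l m : (0 < l)%R -> (0 < m)%R ->
    modular p (fun x => \1_Q x / l)%R <= 1 ->
    modular (conjugate p) (fun x => \1_Q x / m)%R <= 1 ->
    N <= (8 * (l * m))%:E.
  move=> l0 m0 pl pm.
  have := vnorm_indic_interp hp' th01 m0 pm.
  have := vnorm_indic_interp hp th01 l0 pl.
  move=> /lee_pmul/[apply]; rewrite !luxemburg_ge0.
  move=> /(_ isT isT)/le_trans; apply.
  have Vlm := indic_holder hp l0 m0 pl pm.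
  have lm0 : (0 < l * m)%R by rewrite mulr_gt0.
  rewrite -EFinM lee_fin.
  have -> : (2 * (l `^ th * (V `^ 2^-1) `^ (1 - th)) *
      (2 * (m `^ th * (V `^ 2^-1) `^ (1 - th))) =
      4 * ((l * m) `^ th * V `^ (1 - th)))%R.
    rewrite powRM ?ltW//.
    have -> : (V `^ (1 - th) =
        (V `^ 2^-1) `^ (1 - th) * (V `^ 2^-1) `^ (1 - th))%R.
      rewrite -powRM ?powR_ge0//; congr (_ `^ _)%R.
      rewrite -powRD; last by apply/implyP => _; rewrite gt_eqF.
      by rewrite -{1}[V]powRr1 ?ltW//; congr (_ `^ _)%R; lra.
    ring.
  have Vth : (V `^ (1 - th) <= 2 * (l * m) `^ (1 - th))%R.
    apply: (@le_trans _ _ ((2 * (l * m)) `^ (1 - th))%R).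
      apply: ge0_ler_powR => //.
      - by rewrite subr_ge0 ltW.
      - by rewrite nnegrE ltW.
      by rewrite nnegrE mulr_ge0// ltW.
    rewrite powRM ?(ltW lm0)// ler_pM2r ?powR_gt0//.
    by rewrite ler1_powR ?ler1n// gerBl.
  have lmE : ((l * m) `^ th * (l * m) `^ (1 - th) = l * m)%R.
    rewrite -powRD ?subrKC ?powRr1 ?ltW//.
    by apply/implyP => _; rewrite gt_eqF.
  apply: (@le_trans _ _ (4 * ((l * m) `^ th * (2 * (l * m) `^ (1 - th))))%R).
    by rewrite ler_pM2l// ler_pM2l// powR_gt0.
  by rewrite (mulrCA ((l * m) `^ th))%R lmE; lra.
have [l0 l00 pl0] := modular_indic_bounded hp.
have [m0 m00 pm0] := modular_indic_bounded hp'.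
set P := vnorm p \1_Q; set P' := vnorm (conjugate p) \1_Q.
have P_ge0 : 0 <= P by exact: luxemburg_ge0.
have P'_ge0 : 0 <= P' by exact: luxemburg_ge0.
have Pfin : P \is a fin_num.
  by rewrite ge0_fin_numE// (le_lt_trans (luxemburg_le l00 pl0))// ltry.
have P'fin : P' \is a fin_num.
  by rewrite ge0_fin_numE// (le_lt_trans (luxemburg_le m00 pm0))// ltry.
have key' l : (0 < l)%R -> modular p (fun x => \1_Q x / l)%R <= 1 ->
    N <= (8 * l)%:E * P'.
  move=> l_gt0 pl; have l8 : (0 < 8 * l)%R by rewrite mulr_gt0.
  rewrite -lee_pdivrMl//; apply: le_luxemburg => m m_gt0 pm.
  by rewrite lee_pdivrMl// -EFinM -mulrA key.
(* A vanishing norm of the conjugate cannot be divided out. *)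
move: P'_ge0 key'; rewrite -(fineK P'fin) lee_fin le_eqVlt.
move=> /predU1P[<- key'|P'0 key'].
  by have := key' _ l00 pl0; rewrite !mule0.
set b := fine P' in P'0 key' *; have b8 : (0 < 8 * b)%R by rewrite mulr_gt0.
have : ((8 * b)^-1)%:E * N <= P.
  apply: le_luxemburg => l l_gt0 pl; rewrite lee_pdivrMl// -EFinM.
  by rewrite mulrAC EFinM key'.
by rewrite lee_pdivrMl// EFinM -muleA [P * _]muleC.
Qed.

End muckenhoupt_interpolation.

Lemma muckenhoupt_const_exponent_approx (R : realType) (n : nat)
    (p : Rn R n -> \bar R) k : exponent p -> (0 < k)%N ->
  muckenhoupt_const (exponent_approx p k) <= 8%:E * muckenhoupt_const p.
Proof.
move=> hp k0; apply: ge_ereal_sup => _ [_ [a [l [l0 ->]]] <-].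
have [mQ QV] := lebesgue_cube a l0.
have V0 : (0 < l ^+ n)%R by rewrite exprn_gt0.
have := vnorm_indic_interp_prod mQ QV V0 hp (weight_lt1 k0).
rewrite -exponent_approxE => le8.
have V_ge0 : 0 <= (lebesgue (cube a l))^-1 by rewrite inve_ge0.
apply: le_trans (lee_wpmul2r V_ge0 le8) _.
rewrite -muleA lee_pmul2l//; apply: ereal_sup_ubound.
by exists (cube a l) => //; exists a, l.
Qed.

(** * Interpolation of the Nekvinda condition *)

Section nekvinda_approx.
Context {R : realType} {n : nat} (n0 : (0 < n)%N).
Local Notation mu := (@lebesgue R n).
Implicit Types (p s : Rn R n -> \bar R) (q : \bar R) (c l th : R).

Lemma lebesgue_setT : mu setT = +oo.
Proof.
apply/eqyP => A A0; pose l := Num.max 1%R A.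
have l1 : (1 <= l)%R by rewrite le_max lexx.
have l0 : (0 < l)%R by exact: lt_le_trans l1.
have [mQ QV] := lebesgue_cube (nseq_tuple n 0%R) l0.
apply: (@le_trans _ _ (mu (cube (nseq_tuple n 0%R) l))); last first.
  by apply: le_measure; rewrite ?inE.
rewrite [leRHS]QV lee_fin; apply: (@le_trans _ _ l).
  by rewrite le_max lexx orbT.
by rewrite -{1}[l]expr1 ler_weXn2l.
Qed.

Lemma integral_cst_lebesgue c : (0 < c)%R -> \int[mu]_x c%:E = +oo.
Proof.
move=> c0; transitivity (c%:E * mu setT).
  by apply: integral_cst; exact: measurableT.
by rewrite lebesgue_setT gt0_muley.
Qed.

Lemma measurable_modular_cst s l : exponent s ->
  measurable_fun setT (fun x : Rn R n => epow `|cst 1 x / l|%R (s x)).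
Proof.
move=> hs; apply: (measurable_modular (f := fun x => (cst 1 x / l)%R) hs).
exact: (measurable_cst (1 / l)%R).
Qed.

(** For [l < 1] the integrand is at least [1] everywhere, and the space has
    infinite measure. *)
Lemma modular_one_ge1 s l : exponent s -> (0 < l)%R ->
  modular s (fun x => cst 1 x / l)%R <= 1 -> (1 <= l)%R.
Proof.
move=> hs l0 sl; rewrite leNgt; apply/negP => l1.
have [_ s1] := hs.
suff : +oo <= (1 : \bar R) by rewrite leye_eq.
apply: le_trans sl; rewrite -(integral_cst_lebesgue ltr01).
apply: ge0_le_integralT.
- by move=> x; rewrite lee_fin.
- exact: measurable_cst.
- exact: measurable_modular_cst.
move=> x; rewrite /cst mul1r ger0_norm ?invr_ge0 ?(ltW l0)//.
have lV1 : (1 < l^-1)%R by rewrite invf_gt1.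
have [->|[r -> r1]] := exponent_valueP (s1 x).
  by rewrite /= ifF ?leey//; apply/negbTE; rewrite -ltNge.
by rewrite lee_fin (le_trans _ (le1r_powR _ r1))// ltW.
Qed.

(** The norm of the constant [1] only tests numbers [l >= 1], and powers of
    [1 / l <= 1] decrease with the exponent. *)
Lemma vnorm_one_le s s' : exponent s -> exponent s' ->
  (forall x, s x <= s' x) ->
  vnorm s' (cst 1%R) <= vnorm s (cst 1%R).
Proof.
move=> hs hs' ss'; apply: le_luxemburg => l l0 sl.
have l1 := modular_one_ge1 hs l0 sl; have [_ s1] := hs.
apply: luxemburg_le => //; apply: le_trans sl; apply: ge0_le_integralT.
- by move=> x; exact: epow_ge0.
- exact: measurable_modular_cst.
- exact: measurable_modular_cst.
move=> x; rewrite /cst mul1r ger0_norm ?invr_ge0 ?(ltW l0)//.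
by apply: epow_ge_exponent => //; rewrite invr_gt0 l0 invf_le1.
Qed.

(** Interpolating [p] and its limit [q] with the same [th] multiplies
    [|1 / p - 1 / q|] by [th], hence only increases the exponent whose
    reciprocal it is. *)
Lemma nekvinda_exponent_interp p q th x : (0 <= th < 1)%R -> 1 <= q ->
  1 <= p x ->
  nekvinda_exponent p q x <=
  nekvinda_exponent (fun x => interp th (p x)) (interp th q) x.
Proof.
move=> /andP[th0 th1] q1 px1; rewrite /nekvinda_exponent /interp !inveK.
have [-> _] := inve_exponent px1; have [-> _] := inve_exponent q1.
rewrite lee_pV2 ?inE ?abse_ge0//.
set u := fine (p x)^-1; set v := fine q^-1.
change (`|((1 - th) / 2 + th * u - ((1 - th) / 2 + th * v))%R%:E| <=
  `|(u - v)%R%:E|).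
rewrite !abse_EFin lee_fin.
have -> : ((1 - th) / 2 + th * u - ((1 - th) / 2 + th * v) = th * (u - v))%R.
  by ring.
by rewrite normrM ger0_norm// ler_piMl// ltW.
Qed.

(** If [1 / q] and [1 / q'] are at distance [2 d], then at each point one of
    the two exponents [1 / |1 / p - 1 / q|], [1 / |1 / p - 1 / q'|] is at most
    [1 / d]. So the two integrands add up to at least a positive constant, whose
    integral is infinite. Uniqueness identifies the limit chosen in the Nekvinda
    constant of the approximation. *)
Lemma nekvinda_limits_unique p q q' : exponent p ->
  nekvinda_limits p q -> nekvinda_limits p q' -> q = q'.
Proof.
move=> hp [q1 [_ /ereal_inf_lt[_ [l [l0 pl] <-] _]]].
move=> [q'1 [_ /ereal_inf_lt[_ [l' [l'0 pl'] <-] _]]].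
have [_ p1] := hp.
have hs := exponent_nekvinda q1 hp; have hs' := exponent_nekvinda q'1 hp.
have [_ s1] := hs; have [_ s'1] := hs'.
apply/eqP; apply/negPn/negP => qq'.
have [vE _] := inve_exponent q1; have [v'E _] := inve_exponent q'1.
set v := fine q^-1 in vE; set v' := fine q'^-1 in v'E.
have vv' : v != v'.
  by apply: contra_neq qq' => vv'; rewrite -[q]inveK vE vv' -v'E inveK.
pose d := (`|v - v'| / 2)%R.
have d0 : (0 < d)%R by rewrite divr_gt0// normr_gt0 subr_eq0.
(* A common L lets the two integrands be compared with the same base. *)
pose L := Num.max l l'; have L0 : (0 < L)%R by rewrite lt_max l0.
have L1 : (1 <= L)%R by rewrite le_max (modular_one_ge1 hs l0 pl).
have t01 : (0 < L^-1 <= 1)%R by rewrite invr_gt0 L0 invf_le1.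
have LV0 : (0 <= L^-1)%R by rewrite invr_ge0 ltW.
have small (w : \bar R) : 1 <= w -> w <= (d^-1)%:E ->
    (L^-1 `^ d^-1)%:E <= epow L^-1 w.
  by move=> w1 wd; exact: (epow_ge_exponent t01 w1 wd).
suff : +oo <= (1 + 1 : \bar R) by rewrite -EFinD leye_eq.
apply: le_trans (leeD pl pl').
have ms := measurable_modular_cst l hs.
have ms' := measurable_modular_cst l' hs'.
rewrite /modular -(ge0_integralDT _ _ ms _ ms'); last 2 first.
- by move=> x; exact: epow_ge0.
- by move=> x; exact: epow_ge0.
have c0 : (0 < L^-1 `^ d^-1)%R by rewrite powR_gt0// invr_gt0.
rewrite -(integral_cst_lebesgue c0); apply: ge0_le_integralT.
- by move=> x; rewrite lee_fin ltW.
- exact: measurable_cst.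
- exact: emeasurable_funD ms ms'.
move=> x; rewrite /cst !mul1r !ger0_norm ?invr_ge0 ?(ltW l0) ?(ltW l'0)//.
have le1 : epow L^-1 (nekvinda_exponent p q x) <=
    epow l^-1 (nekvinda_exponent p q x).
  by apply: epow_le => //; rewrite LV0 lef_pV2 ?posrE// le_max lexx.
have le2 : epow L^-1 (nekvinda_exponent p q' x) <=
    epow l'^-1 (nekvinda_exponent p q' x).
  by apply: epow_le => //; rewrite LV0 lef_pV2 ?posrE// le_max lexx orbT.
have [uE _] := inve_exponent (p1 x); set u := fine (p x)^-1 in uE.
have bound (w : R) : (d <= `|u - w|)%R -> `|u%:E - w%:E|^-1 <= (d^-1)%:E.
  move=> dw; rewrite -EFinB abse_EFin inve_fin ?(lt_le_trans d0)//.
  by rewrite lee_fin lef_pV2 ?posrE// (lt_le_trans d0).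
have [dv|vd] := leP d `|u - v|%R.
  apply: le_trans (leeDl _ (epow_ge0 _ _)).
  apply: le_trans le1; apply: small => //.
  by rewrite /nekvinda_exponent uE vE; exact: bound.
have dv' : (d <= `|u - v'|)%R.
  rewrite leNgt; apply/negP => v'd.
  have : (`|v - v'| <= `|u - v| + `|u - v'|)%R.
    by rewrite (distrC u v); exact: ler_distD.
  by apply/negP; rewrite -ltNge /d in vd v'd *; lra.
apply: le_trans (leeDr _ (epow_ge0 _ _)).
apply: le_trans le2; apply: small => //.
by rewrite /nekvinda_exponent uE v'E; exact: bound.
Qed.

Lemma nekvinda_exponent_approx p k : exponent p -> (0 < k)%N -> nekvinda p ->
  nekvinda (exponent_approx p k) /\
  nekvinda_const (exponent_approx p k) <= nekvinda_const p.
Proof.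
move=> hp k0 np; rewrite /nekvinda_const exponent_approxE.
have := @weight_lt1 R k k0; move: (weight k) => th th01.
have hip := exponent_interp th01 hp; have [_ p1] := hp.
have := xgetPex +oo np; set q := xget _ _ => -[q1 [_ qfin]].
have iq1 : 1 <= interp th q.
  by have [r [-> r1 _]] := interpE th01 q1; rewrite lee_fin.
have le_norm : vnorm (nekvinda_exponent (fun x => interp th (p x))
    (interp th q)) (cst 1%R) <= vnorm (nekvinda_exponent p q) (cst 1%R).
  apply: vnorm_one_le => [||x]; try exact: exponent_nekvinda.
  exact: nekvinda_exponent_interp.
have lim_iq : nekvinda_limits (fun x => interp th (p x)) (interp th q).
  split=> //; split; first exact: measurable_cst.
  exact: le_lt_trans le_norm qfin.
split; first by exists (interp th q).
rewrite (xget_unique _ lim_iq) // => y /(nekvinda_limits_unique hip).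
exact.
Qed.

End nekvinda_approx.

(** * Limits of modulars and norms *)

Section ereal_limits.
Context {R : realType}.
Implicit Types (u : nat -> \bar R) (x y l : \bar R) (a b : R).

Lemma ereal_dense x y : x < y -> exists a, x < a%:E < y.
Proof.
case: x => [r| |]; case: y => [s| |] //.
- by rewrite lte_fin => rs; exists ((r + s) / 2)%R; rewrite !lte_fin !midf_lt.
- by move=> _; exists (r + 1)%R; rewrite lte_fin ltrDl ltr01 ltry.
- by move=> _; exists (s - 1)%R; rewrite ltNyr lte_fin gtrBl ltr01.
- by move=> _; exists 0%R; rewrite ltNyr ltry.
Qed.

Lemma cvge_lower u l a : u @ \oo --> l -> a%:E < l ->
  \forall k \near \oo, a%:E < u k.
Proof.
move=> ul al; apply: (ul [set y | a%:E < y]).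
by apply: open_nbhs_nbhs; split=> //; exact: open_ereal_gt_ereal.
Qed.

Lemma cvge_upper u l b : u @ \oo --> l -> l < b%:E ->
  \forall k \near \oo, u k < b%:E.
Proof.
move=> ul lb; apply: (ul [set y | y < b%:E]).
by apply: open_nbhs_nbhs; split=> //; exact: open_ereal_lt_ereal.
Qed.

(** Convergence in the extended line tested on real bounds, so that an infinite
    limit needs no separate treatment in the applications. *)
Lemma cvge_bounds u l :
  (forall a, a%:E < l -> \forall k \near \oo, a%:E < u k) ->
  (forall b, l < b%:E -> \forall k \near \oo, u k < b%:E) ->
  u @ \oo --> l.
Proof.
case: l => [r| |] lower upper.
- have fin_u : \forall k \near \oo, u k \is a fin_num.
    near=> k; rewrite fin_numElt; apply/andP; split.
      apply: (@lt_trans _ _ (r - 1)%:E); rewrite ?ltNyr//.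
      by near: k; apply: lower; rewrite lte_fin gtrBl.
    apply: (@lt_trans _ _ (r + 1)%:E); rewrite ?ltry//.
    by near: k; apply: upper; rewrite lte_fin ltrDl.
  apply: cvg_EFin => //; apply/cvgrPdist_lt => e e0; near=> k => /=.
  rewrite ltr_distlC -!lte_fin fineK; last by near: k.
  apply/andP; split; near: k.
    by apply: lower; rewrite lte_fin gtrBl.
  by apply: upper; rewrite lte_fin ltrDl.
- by apply/cvgeyPgt => a; apply: lower; rewrite ltry.
- by apply/cvgeNyPlt => b; apply: upper; rewrite ltNyr.
Unshelve. all: by end_near. Qed.

Lemma limn_einfE u : limn_einf u = ereal_sup (range (einfs u)).
Proof. by rewrite limn_einf_lim; apply/cvg_lim => //; exact: cvg_einfs_sup. Qed.

Lemma le_limn_einf u l :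
  (forall a, a%:E < l -> \forall k \near \oo, a%:E < u k) -> l <= limn_einf u.
Proof.
move=> lower; rewrite leNgt; apply/negP => /ereal_dense[a /andP[ua al]].
have [N _ Na] := lower _ al; move: ua; apply/negP; rewrite -leNgt limn_einfE.
apply: le_trans (ereal_sup_ubound _); last by exists N.
apply: le_ereal_inf_tmp => _ [k /= Nk <-]; apply: ltW; exact: Na.
Qed.

Lemma lt_limn_einf u a : a%:E < limn_einf u -> \forall k \near \oo, a%:E < u k.
Proof.
rewrite limn_einfE => /ereal_sup_gt[_ [N _ <-] aN]; exists N => // k /= Nk.
by apply: lt_le_trans aN _; apply: ereal_inf_lbound; exists k.
Qed.

End ereal_limits.

Section modular_limits.
Context {R : realType} {n : nat}.
Local Notation mu := (@lebesgue R n).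
Implicit Types (p : Rn R n -> \bar R) (f : Rn R n -> R) (t a b c l : R).

(** The pointwise lower bound that Fatou's lemma integrates. It follows from
    continuity in the exponent where [p] is finite. Where [p = +oo] it is
    trivial for [t <= 1], while [t ^ (k + 1) / (k + 1)] tends to [+oo] for
    [t > 1]. *)
Lemma epow_div_exponent_approx p x t a : 1 <= p x -> (0 <= t)%R ->
  a%:E < epow_div t (p x) ->
  \forall k \near \oo, a%:E < epow_div t (exponent_approx p k x).
Proof.
move=> px1 t0 at_; have [a0|a0] := ltP a 0%R.
  near=> k; have k0 : (0 < k)%N by near: k; exact: nbhs_infty_gt.
  have [r [-> r1 _]] := exponent_approx_fin k0 px1.
  by apply: (@lt_le_trans _ _ 0); rewrite ?lte_fin// epow_div_ge0.
move: t0; rewrite le_eqVlt => /predU1P[t0|t0].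
  move: at_ px1; rewrite -t0; case: (p x) => [r| |]//=; last first.
    by rewrite ler01 lte_fin ltNge a0.
  rewrite lte_fin lee_fin => + r1.
  by rewrite powR0 ?gt_eqF ?(lt_le_trans _ r1)// mulr0 ltNge a0.
have [pxy|[r pxr r1]] := exponent_valueP px1.
  have t1 : (1 < t)%R.
    move: at_; rewrite pxy /=; case: (leP t 1%R) => //.
    by rewrite lte_fin ltNge a0.
  have L0 : (0 < ln t)%R by rewrite ln_gt0.
  have c0 : (0 < ln t ^+ 2 / 4)%R by rewrite divr_gt0 ?exprn_gt0.
  near=> k; have k0 : (0 < k)%N by near: k; exact: nbhs_infty_gt.
  have [s [-> s1]] := exponent_approx_fin k0 px1.
  rewrite pxy invey mulr0 addr0 => /invr_inj ->.
  set y := (k%:R + 1 : R)%R; have y0 : (0 < y)%R by rewrite /y natr1.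
  rewrite lte_fin; apply: (@lt_le_trans _ _ (y * (ln t ^+ 2 / 4))%R).
    rewrite -ltr_pdivrMr//; apply: (@lt_le_trans _ _ k%:R%R).
      by near: k; exact: nbhs_infty_gtr.
    by rewrite /y lerDl.
  rewrite ler_pdivlMl// /powR gt_eqF//.
  have -> : (y * (y * (ln t ^+ 2 / 4)) = (y * ln t / 2) ^+ 2)%R by field.
  have -> : (y * ln t = y * ln t / 2 + y * ln t / 2)%R by lra.
  (* exp (2 z) = (exp z)^2 >= z^2 makes the power beat the division by k + 1. *)
  rewrite expRD -expr2; have z0 : (0 <= y * ln t / 2)%R.
    by rewrite !mulr_ge0// ltW.
  rewrite (_ : (y * ln t / 2 + y * ln t / 2) / 2 = y * ln t / 2)%R; last by lra.
  rewrite ler_sqr ?nnegrE ?expR_ge0//.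
  by apply: le_trans (expR_ge1Dx _); rewrite lerDr.
have r0 : (0 < r)%R by exact: lt_le_trans r1.
have := exponent_approx_cvg px1; rewrite pxr => /fine_cvg pk.
apply: (@cvge_lower _ _ (epow_div t (p x))) => //.
have : (fun k => (fine (exponent_approx p k x))^-1 *
    t `^ fine (exponent_approx p k x))%R @ \oo --> (r^-1 * t `^ r)%R.
  apply: cvgM; first by apply: cvgV => //; rewrite gt_eqF.
  rewrite /powR gt_eqF//.
  apply: (@continuous_cvg _ _ _ _ _ _ expR); first exact: continuous_expR.
  by apply: cvgM => //; exact: cvg_cst.
move=> h; rewrite pxr; apply: cvg_EFin.
  near=> k; have k0 : (0 < k)%N by near: k; exact: nbhs_infty_gt.
  by have [s [-> _ _]] := exponent_approx_fin k0 px1.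
apply: cvg_trans h; apply: near_eq_cvg; near=> k.
have k0 : (0 < k)%N by near: k; exact: nbhs_infty_gt.
by rewrite /=; have [s [-> _ _]] := exponent_approx_fin k0 px1.
Unshelve. all: by end_near. Qed.

Definition square_integrable f :=
  measurable_fun setT f /\ \int[mu]_x (`|f x| ^+ 2)%:E < +oo.

Lemma measurable_fun_norm_sqr f : measurable_fun setT f ->
  measurable_fun setT (fun x => (`|f x| ^+ 2)%:E).
Proof.
move=> mf; apply/measurable_EFinP; apply: measurable_funX.
exact: (measurableT_comp (@normr_measurable R setT) mf).
Qed.

Lemma modular_tilde_ge0 p f : exponent p -> 0 <= modular_tilde p f.
Proof. by move=> [_ p1]; apply: integral_ge0 => x _; exact: epow_div_ge0. Qed.

(** Integrated form of [epow_div_interp]: the square integral enters with the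
    coefficient [1 / (k + 1)], so the bound is asymptotically sharp. *)
Lemma modular_tilde_exponent_approx_le p f k : exponent p ->
  measurable_fun setT f -> (0 < k)%N ->
  modular_tilde (exponent_approx p k) f <=
  modular_tilde p f + (k%:R + 1)^-1%:E * \int[mu]_x (`|f x| ^+ 2)%:E.
Proof.
move=> hp mf k0; have hpk := exponent_approx_exponent hp k0.
have [_ p1] := hp; have [_ pk1] := hpk.
have m2 := measurable_fun_norm_sqr mf.
have sq0 x : 0 <= (`|f x| ^+ 2)%:E by rewrite lee_fin sqr_ge0.
have kV0 : (0 <= (k%:R + 1)^-1 :> R)%R by rewrite invr_ge0 natr1.
have mk2 : measurable_fun setT (fun x => (k%:R + 1)^-1%:E * (`|f x| ^+ 2)%:E).
  exact: measurable_funeM m2.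
have mp := measurable_modular_tilde hp mf.
rewrite -(ge0_integralZlT _ kV0 sq0 m2) /modular_tilde -ge0_integralDT//.
- apply: ge0_le_integralT.
  + by move=> x; exact: epow_div_ge0.
  + exact: measurable_modular_tilde hpk mf.
  + exact: emeasurable_funD mp mk2.
  move=> x; rewrite exponent_approxE -EFinM -half_onem_weight.
  by apply: epow_div_interp => //; exact: weight_lt1.
- by move=> x; exact: epow_div_ge0.
Qed.

Lemma modular_tilde_fatou p f a : exponent p -> measurable_fun setT f ->
  a%:E < modular_tilde p f ->
  \forall k \near \oo, a%:E < modular_tilde (exponent_approx p k) f.
Proof.
move=> hp mf apf; have [mp p1] := hp.
have hpk k : exponent (exponent_approx p k.+1).
  exact: exponent_approx_exponent.
(* The shift avoids k = 0, where the weight of 1 / p x is negative. *)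
pose F k x := epow_div `|f x|%R (exponent_approx p k.+1 x).
have mF k : measurable_fun setT (F k).
  exact: measurable_modular_tilde (hpk k) mf.
have F0 k x : 0 <= F k x by have [_ pk1] := hpk k; exact: epow_div_ge0.
have : modular_tilde p f <= limn_einf (fun k => \int[mu]_x F k x).
  apply: le_trans (fatou mu measurableT mF (fun k x _ => F0 k x)).
  apply: ge0_le_integralT.
  - by move=> x; exact: epow_div_ge0.
  - exact: measurable_modular_tilde hp mf.
  - rewrite /limn_einf; apply: (measurableT_comp (@oppe_measurable R setT)).
    apply: measurable_fun_limn_esup => k.
    exact: (measurableT_comp (@oppe_measurable R setT) (mF k)).
  move=> x; apply: le_limn_einf => b bx.
  have [N _ Nb] := epow_div_exponent_approx (p1 x) (normr_ge0 _) bx.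
  by exists N => // k /= Nk; apply: Nb => /=; exact: leqW.
move=> /(lt_le_trans apf)/lt_limn_einf[N _ Na].
by exists N.+1 => // -[//|k] /= Nk; exact: Na.
Qed.

Lemma modular_tilde_exponent_approx_cvg p f : exponent p ->
  square_integrable f ->
  modular_tilde (exponent_approx p k) f @[k --> \oo] --> modular_tilde p f.
Proof.
move=> hp [mf f2]; apply: cvge_bounds => [a|b pb].
  exact: modular_tilde_fatou.
have pf0 := modular_tilde_ge0 f hp.
have pfin : modular_tilde p f \is a fin_num.
  by rewrite ge0_fin_numE// (lt_trans pb)// ltry.
have C0 : 0 <= \int[mu]_x (`|f x| ^+ 2)%:E.
  by apply: integral_ge0 => x _; rewrite lee_fin sqr_ge0.
have Cfin : \int[mu]_x (`|f x| ^+ 2)%:E \is a fin_num by rewrite ge0_fin_numE.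
have le_k k := @modular_tilde_exponent_approx_le p f k hp mf.
move: C0 Cfin pfin pb le_k; move: (\int[mu]_x _) (modular_tilde p f).
move=> [C| |]// [r| |]//; rewrite lee_fin lte_fin => C0 _ _ rb le_k.
have e0 : (0 < (b - r) / (C + 1))%R by rewrite divr_gt0 ?subr_gt0 ?ltr_wpDl.
near=> k; apply: le_lt_trans (le_k k _) _.
  by near: k; exact: nbhs_infty_gt.
rewrite -EFinM -EFinD lte_fin -ltrBrDl natr1.
have kV0 : (0 < k.+1%:R^-1 :> R)%R by rewrite invr_gt0.
apply: (@le_lt_trans _ _ (k.+1%:R^-1 * (C + 1))%R).
  by rewrite ler_wpM2l ?(ltW kV0)// lerDl.
rewrite -ltr_pdivlMr ?ltr_wpDl//.
by near: k; exact: (near_infty_natSinv_lt (PosNum e0)).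
Unshelve. all: by end_near. Qed.

Lemma square_integrable_divr f l : (0 < l)%R -> square_integrable f ->
  square_integrable (fun x => f x / l)%R.
Proof.
move=> l0 [mf f2]; split; first exact: measurable_fun_divr.
have l2 : (0 <= l^-1 ^+ 2)%R by exact: sqr_ge0.
have m2 := measurable_fun_norm_sqr mf.
have sq0 x : 0 <= (`|f x| ^+ 2)%:E by rewrite lee_fin sqr_ge0.
under eq_integral => x _.
  rewrite normrM exprMn (ger0_norm (_ : 0 <= l^-1)%R); last first.
    by rewrite invr_ge0 ltW.
  rewrite mulrC EFinM; over.
rewrite (ge0_integralZlT _ l2 sq0 m2).
by apply: lte_mul_pinfty.
Qed.

(** Enlarging [l] to [m > l] strictly decreases a positive finite modular. This
    is what turns an admissible [l], where the modular may equal [1], into one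
    where it is strictly less than [1], an open condition that passes to the
    approximations. *)
Lemma modular_tilde_scale p f l m : exponent p -> measurable_fun setT f ->
  (0 < l)%R -> (l <= m)%R ->
  modular_tilde p (fun x => f x / m)%R <=
    (l / m)%:E * modular_tilde p (fun x => f x / l)%R.
Proof.
move=> hp mf l0 lm; have [_ p1] := hp.
have m0 : (0 < m)%R by exact: lt_le_trans lm.
have lm01 : (0 < l / m <= 1)%R by rewrite divr_gt0// ler_pdivrMr// mul1r.
have lm_ge0 : (0 <= l / m)%R by have /andP[/ltW] := lm01.
have mfl := measurable_modular_tilde hp (measurable_fun_divr l mf).
have fl0 x : 0 <= epow_div `|f x / l|%R (p x) by exact: epow_div_ge0.
rewrite /modular_tilde -(ge0_integralZlT _ lm_ge0 fl0 mfl).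
apply: ge0_le_integralT.
- by move=> x; exact: epow_div_ge0.
- exact: measurable_modular_tilde hp (measurable_fun_divr m mf).
- exact: measurable_funeM.
move=> x; apply: le_trans (epow_div_scale lm01 (normr_ge0 _) (p1 x)).
rewrite le_eqVlt; apply/orP; left; apply/eqP; congr epow_div.
rewrite -[X in _ = (X * _)%R](ger0_norm lm_ge0) -normrM; congr (Num.norm _).
by field; rewrite !gt_eqF.
Qed.

Lemma modular_tilde_le1 p f l m : exponent p -> measurable_fun setT f ->
  (0 < l)%R -> (l <= m)%R -> modular_tilde p (fun x => f x / l)%R <= 1 ->
  modular_tilde p (fun x => f x / m)%R <= 1.
Proof.
move=> hp mf l0 lm pl; apply: le_trans (modular_tilde_scale hp mf l0 lm) _.
have m0 : (0 < m)%R by exact: lt_le_trans lm.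
apply: (@le_trans _ _ ((l / m)%:E * 1)).
  by rewrite lee_wpmul2l// lee_fin divr_ge0// ltW.
by rewrite mule1 lee_fin ler_pdivrMr// mul1r.
Qed.

(** Above the norm pick an admissible [l] and enlarge it slightly: the modular
    becomes less than [1], hence also for large [k]. Below the norm the modular
    exceeds [1], hence also for large [k], and then no smaller number is
    admissible either. *)
Lemma vnorm_tilde_exponent_approx_cvg p f : exponent p ->
  square_integrable f ->
  vnorm_tilde (exponent_approx p k) f @[k --> \oo] --> vnorm_tilde p f.
Proof.
move=> hp sf; have [mf _] := sf.
apply: cvge_bounds => [a ap|b /ereal_inf_lt[_ [l [l0 pl] <-]]].
  have [a0|a0] := ltP a 0%R.
    apply: nearW => k; apply: (@lt_le_trans _ _ 0); first by rewrite lte_fin.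
    exact: luxemburg_ge0.
  have [l /andP[al lp]] := ereal_dense ap; rewrite lte_fin in al.
  have l0 : (0 < l)%R by exact: le_lt_trans al.
  have pl : 1%:E < modular_tilde p (fun x => f x / l)%R.
    rewrite ltNge; apply: contraTN lp => pl.
    by rewrite -leNgt; exact: luxemburg_le.
  have := cvge_lower (modular_tilde_exponent_approx_cvg hp
    (square_integrable_divr l0 sf)) pl.
  move=> near_pl; near=> k.
  have k0 : (0 < k)%N by near: k; exact: nbhs_infty_gt.
  apply: (@lt_le_trans _ _ l%:E); first by rewrite lte_fin.
  apply: le_luxemburg => m m0 pm; rewrite lee_fin leNgt; apply/negP => ml.
  have hpk := exponent_approx_exponent hp k0.
  have := modular_tilde_le1 hpk mf m0 (ltW ml) pm.
  apply/negP; rewrite -ltNge; near: k; exact: near_pl.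
rewrite lte_fin => lb; pose m := ((l + b) / 2)%R.
have lm : (l < m)%R by rewrite /m; lra.
have mb : (m < b)%R by rewrite /m; lra.
have m0 : (0 < m)%R by exact: lt_trans lm.
have pm : modular_tilde p (fun x => f x / m)%R < 1%:E.
  apply: le_lt_trans (modular_tilde_scale hp mf l0 (ltW lm)) _.
  apply: (@le_lt_trans _ _ ((l / m)%:E * 1)).
    by rewrite lee_wpmul2l// lee_fin divr_ge0// ltW.
  by rewrite mule1 lte_fin ltr_pdivrMr// mul1r.
have near_pm := cvge_upper (modular_tilde_exponent_approx_cvg hp
  (square_integrable_divr m0 sf)) pm.
near=> k; apply: (@le_lt_trans _ _ m%:E); last by rewrite lte_fin.
by apply: luxemburg_le => //; apply: ltW; near: k; exact: near_pm.
Unshelve. all: by end_near. Qed.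

Lemma Lfun2_square_integrable f : f \in Lfun mu 2%:E -> square_integrable f.
Proof.
move=> f2; split; first exact: set_mem (sub_Lfun_mfun f2).
have /(integrable_lty measurableT) := Lfun_integrable (ler1n R 2) f2.
by under eq_integral do rewrite powR_mulrn//.
Qed.

End modular_limits.

(** * The approximation theorem *)

Theorem lemma4p4 (R : realType) (n : nat) (hn : (0 < n)%N)
    (p : Rn R n -> \bar R) (hp : exponent p) :
  (* well-definedness of p_k *)
  (forall k : nat, (0 < k)%N -> exponent (exponent_approx p k)) /\
  (* (1) *)
  {uniform [set: Rn R n],
    (fun (k : nat) (x : Rn R n) => fine (exponent_approx p k x)^-1) @ \oo -->
    (fun x : Rn R n => fine (p x)^-1)} /\
  (* (2) *)
  {ae @lebesgue R n, forall x, exponent_approx p k x @[k --> \oo] --> p x} /\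
  (* (3) *)
  (forall k : nat, (0 < k)%N ->
    [/\ (1 + k%:R^-1)%:E <= ess_inf (@lebesgue R n) (exponent_approx p k),
        ess_inf (@lebesgue R n) (exponent_approx p k) <=
          ess_sup (@lebesgue R n) (exponent_approx p k),
        ess_sup (@lebesgue R n) (exponent_approx p k) <= (k%:R + 1)%:E,
        Order.min (ess_inf (@lebesgue R n) p) 2%:E <=
          ess_inf (@lebesgue R n) (exponent_approx p k) &
        ess_sup (@lebesgue R n) (exponent_approx p k) <=
          Order.max (ess_sup (@lebesgue R n) p) 2%:E]) /\
  (* (4) *)
  (muckenhoupt p -> forall k : nat, (0 < k)%N ->
    muckenhoupt (exponent_approx p k) /\
    muckenhoupt_const (exponent_approx p k) <= 8%:E * muckenhoupt_const p) /\
  (* (5) *)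
  (nekvinda p -> forall k : nat, (0 < k)%N ->
    nekvinda (exponent_approx p k) /\
    nekvinda_const (exponent_approx p k) <= 2%:E * nekvinda_const p) /\
  (* (6) *)
  (forall f : Rn R n -> R, f \in Lfun (@lebesgue R n) 2%:E ->
    modular_tilde (exponent_approx p k) f @[k --> \oo] --> modular_tilde p f /\
    vnorm_tilde (exponent_approx p k) f @[k --> \oo] --> vnorm_tilde p f).
Proof.
have [_ p1] := hp.
have mu0 : 0 < @lebesgue R n setT by rewrite lebesgue_setT.
split; first by move=> k; exact: exponent_approx_exponent.
split; first exact: exponent_approx_inv_cvg.
split; first by apply: aeW => x; exact: exponent_approx_cvg.
split; first by move=> k; exact: ess_bounds_exponent_approx.
split.
  move=> Ap k k0; have le8 := muckenhoupt_const_exponent_approx hp k0.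
  split; last exact: le8.
  apply: le_lt_trans le8 _.
  by apply: lte_mul_pinfty Ap; rewrite ?lee_fin.
split.
  move=> Np k k0; have [Npk le_const] := nekvinda_exponent_approx hn hp k0 Np.
  split; first exact: Npk.
  apply: le_trans le_const _; rewrite -[leLHS]mul1e.
  by apply: lee_wpmul2r; [exact: luxemburg_ge0|rewrite lee_fin ler1n].
move=> f /Lfun2_square_integrable sf.
split; first exact: modular_tilde_exponent_approx_cvg.
exact: vnorm_tilde_exponent_approx_cvg.
Qed.
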